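(* Let $P$ be a finite poset and $q$ a prime power. Suppose that $La(n,P)=(1+o(1))\Sigma(n,e(P))$ as $n\to\infty$, and that $e_q(P)=e(P)$. Then $La_q(n,P)=(1+o(1))\Sigma_q(n,e_q(P))$ as $n\to\infty$.
   Context: A family $\mathcal{F}$ of subsets of $[n]$ (resp. of subspaces of $\mathbb{F}_q^n$) weakly contains a poset $P$ if there is an injection $f:P\to\mathcal{F}$ such that $x<_P y$ implies $f(x)\subsetneq f(y)$; otherwise $\mathcal{F}$ is $P$-free. $La(n,P)$ is the maximum size of a $P$-free family $\mathcal{F}\subseteq 2^{[n]}$, and $La_q(n,P)$ the maximum size of a $P$-free family of subspaces of $\mathbb{F}_q^n$. Level $i$ of $2^{[n]}$ is the family of $i$-element subsets; level $i$ of the subspace poset is the set of $i$-dimensional subspaces. $e(P)$ is the largest integer $m$ such that for every $n$, every family in $2^{[n]}$ consisting of $m$ consecutive levels is $P$-free; $e_q(P)$ is the largest integer $m$ such that the middle $m$ levels of the subspace poset of $\mathbb{F}_q^n$ do not contain $P$ for any $n$. $\Sigma(n,k)=\sum_{i=1}^k\binom{n}{\lfloor\frac{n-k}{2}\rfloor+i}$ and $\Sigma_q(n,k)=\sum_{i=1}^k{n \brack \lfloor\frac{n-k}{2}\rfloor+i}_q$, with ${n\brack j}_q$ the Gaussian binomial coefficient (number of $j$-dimensional subspaces of $\mathbb{F}_q^n$). *)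

(* Defs.v *)
From HB Require Import structures.
From mathcomp Require Import all_boot all_order all_algebra.
Set Implicit Arguments. Unset Strict Implicit. Unset Printing Implicit Defensive.
Import Order.TTheory GRing.Theory Num.Theory.

(* ---------- Boolean lattice 2^[n] : subsets of 'I_n ---------- *)

(* Fam weakly contains the poset P: an injection f : P -> Fam with
   x <_P y  ==>  f x strictly contained in f y. *)
Definition weakly_contains_set (d : Order.disp_t) (P : finPOrderType d) (n : nat)
    (Fam : {set {set 'I_n}}) : bool :=
  [exists f : {ffun P -> {set 'I_n}},
     [&& injectiveb f, [forall x, f x \in Fam]
       & [forall x, forall y, (x < y)%O ==> (f x \proper f y)]]].

(* La(n,P): maximum size of a P-free family of subsets of [n]. *)
Definition La (d : Order.disp_t) (P : finPOrderType d) (n : nat) : nat :=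
  \max_(Fam : {set {set 'I_n}} | ~~ weakly_contains_set P Fam) #|Fam|.

(* the union of the m consecutive levels i, i+1, ..., i+m-1 of 2^[n] *)
Definition consec_levels (n i m : nat) : {set {set 'I_n}} :=
  [set A : {set 'I_n} | (i <= #|A| < i + m)%N].

Definition e_prop (d : Order.disp_t) (P : finPOrderType d) (m : nat) : Prop :=
  forall n i, ~~ weakly_contains_set P (consec_levels n i m).

(* "m = e(P)" *)
Definition is_e (d : Order.disp_t) (P : finPOrderType d) (m : nat) : Prop :=
  e_prop P m /\ forall m', e_prop P m' -> (m' <= m)%N.

(* ---------- Subspace lattice of F^n (F a finite field, q = #|F|) ----------
   A subspace of F^n (row vectors) is represented canonically by the square
   matrix A with genmx A == A (i.e. A = <<A>>%MS); its dimension is \rank A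
   and strict inclusion is ltmx (the (_ < _)%MS of mxalgebra). *)
Definition is_subspace (F : finFieldType) (n : nat) (A : 'M[F]_n) : bool :=
  genmx A == A.

Definition weakly_contains_sub (d : Order.disp_t) (P : finPOrderType d)
    (F : finFieldType) (n : nat) (Fam : {set 'M[F]_n}) : bool :=
  [exists f : {ffun P -> 'M[F]_n},
     [&& injectiveb f, [forall x, f x \in Fam]
       & [forall x, forall y, (x < y)%O ==> ltmx (f x) (f y)]]].

(* La_q(n,P) *)
Definition La_q (d : Order.disp_t) (P : finPOrderType d) (F : finFieldType)
    (n : nat) : nat :=
  \max_(Fam : {set 'M[F]_n} |
          (Fam \subset [set A : 'M[F]_n | is_subspace A]) && ~~ weakly_contains_sub P Fam)
     #|Fam|.

(* middle m levels: dimensions floor((n-m)/2)+1, ..., floor((n-m)/2)+m *)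
Definition middle_levels_sub (F : finFieldType) (n m : nat) : {set 'M[F]_n} :=
  [set A : 'M[F]_n | is_subspace A && ((n - m)./2 < \rank A <= (n - m)./2 + m)%N].

Definition eq_prop (d : Order.disp_t) (P : finPOrderType d) (F : finFieldType)
    (m : nat) : Prop :=
  forall n, ~~ weakly_contains_sub P (middle_levels_sub F n m).

(* "m = e_q(P)" with q = #|F| *)
Definition is_eq (d : Order.disp_t) (P : finPOrderType d) (F : finFieldType)
    (m : nat) : Prop :=
  eq_prop P F m /\ forall m', eq_prop P F m' -> (m' <= m)%N.

(* ---------- Sigma, Gaussian binomials ---------- *)

Definition Sigma (n k : nat) : nat :=
  \sum_(1 <= i < k.+1) 'C(n, (n - k)./2 + i).

(* Gaussian binomial [n k]_q via the q-Pascal rule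
   [n+1, k+1] = [n, k] + q^(k+1) [n, k+1], [n,0] = 1, [0,k+1] = 0. *)
Fixpoint gauss (q n k : nat) : nat :=
  if n is n'.+1 then
    (if k is k'.+1 then gauss q n' k' + q ^ k * gauss q n' k else 1)
  else (k == 0%N).

Definition Sigma_q (q n k : nat) : nat :=
  \sum_(1 <= i < k.+1) gauss q n ((n - k)./2 + i).

(* f(n) = (1 + o(1)) g(n) as n -> oo *)
Definition asymp_one (f g : nat -> nat) : Prop :=
  forall eps : rat, (0 < eps)%R -> exists N : nat, forall n : nat, (N <= n)%N ->
    (`|(f n)%:R - (g n)%:R| <= eps * (g n)%:R)%R.

(* Main.v *)
Require Import Defs.
From mathcomp Require Import all_boot all_order all_algebra.
From mathcomp Require Import ring lra zify.
Import Order.TTheory GRing.Theory Num.Theory.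
Set Implicit Arguments. Unset Strict Implicit. Unset Printing Implicit Defensive.
Local Open Scope ring_scope.

(* The lower bound holds because the middle m levels of the subspace lattice are
   P-free.  For the upper bound, fix a P-free family Fam of subspaces.  For every
   basis B of F_q^n the subspaces spanned by subsets of B form a copy of the Boolean
   lattice 2^[n], so at most La(n,P) of them lie in Fam.  Averaging over all pairs
   (B, S) with S a subset of B, a k-dimensional subspace is spanned by S for a
   proportion C(n,k)/[n k]_q of the pairs with |S| = k; hence
     sum_{A in Fam} C(n, dim A) / [n, dim A]_q <= La(n,P) <= (1+o(1)) Sigma(n,m).
   Now [n k]_q / C(n,k) = Phi(n) / (Phi(k) Phi(n-k)) with Phi(x) = prod_{t<=x} (q^t-1)/t,
   and (q^t-1)/t is nondecreasing in t, so this ratio increases towards the middle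
   level.  Maximizing |Fam| under the constraint above and |Fam cap level k| <= [n k]_q
   is thus a fractional knapsack problem whose optimum fills the middle m levels,
   which gives |Fam| <= (1+o(1)) Sigma_q(n,m). *)

Lemma gauss_n0 q n : gauss q n 0 = 1%N.
Proof. by case: n. Qed.

Lemma gauss_gt0 q n k : (k <= n)%N -> (0 < gauss q n k)%N.
Proof.
elim: n k => [|n IH] [|k] //= kn.
by rewrite ltn_addr // IH.
Qed.

Section GaussianBinomial.
Variables (R : realFieldType) (q : nat).
Hypothesis q_gt1 : (1 < q)%N.
Local Notation qr := (q%:R : R).
Local Notation G n k := ((gauss q n k)%:R : R).

Lemma ltr_qX i j : (i < j)%N -> qr ^+ i < qr ^+ j.
Proof. by move=> ij; rewrite ltr_eXn2l // ltr1n. Qed.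

Definition qfalling (n k : nat) : R := \prod_(i < k) (qr ^+ n - qr ^+ i).

Lemma qfallingSS n k :
  qfalling n.+1 k.+1 = (qr ^+ n.+1 - 1) * qr ^+ k * qfalling n k.
Proof.
rewrite /qfalling big_ord_recl /= expr0 -mulrA; congr (_ * _).
have -> : qr ^+ k = \prod_(i < k) qr by rewrite prodr_const card_ord.
rewrite -big_split /=.
by apply: eq_bigr => i _; rewrite !exprS mulrBr.
Qed.

Lemma qfallingSr n k : qfalling n k.+1 = qfalling n k * (qr ^+ n - qr ^+ k).
Proof. by rewrite /qfalling big_ord_recr. Qed.

Lemma qfalling_neq0 k : qfalling k k != 0.
Proof.
rewrite /qfalling prodf_seq_neq0; apply/allP => i _ /=.
by rewrite subr_eq0 gt_eqF // ltr_qX.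
Qed.

Lemma gauss_qfalling n k : G n k * qfalling k k = qfalling n k.
Proof.
elim: n k => [|n IH] [|k].
- by rewrite /= /qfalling !big_ord0 mulr1.
- by rewrite /= mul0r /qfalling big_ord_recl expr0 subrr mul0r.
- by rewrite /= /qfalling !big_ord0 mulr1.
have e1 := IH k; have e2 := IH k.+1.
rewrite qfallingSS qfallingSr -e1 in e2.
rewrite /= natrD natrM natrX mulrDl !qfallingSS -e1.
rewrite [X in _ + X](_ : _ = qr ^+ k.+1 * (G n k * qfalling k k * (qr ^+ n - qr ^+ k))).
  by rewrite !exprS; ring.
by rewrite -e2; ring.
Qed.

Lemma gaussS_ratio n k : (k < n)%N ->
  G n k.+1 * (qr ^+ k.+1 - 1) = G n k * (qr ^+ (n - k) - 1).
Proof.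
move=> kn.
have e := gauss_qfalling n k.+1.
rewrite qfallingSS qfallingSr -(gauss_qfalling n k) in e.
have hq : qr ^+ n - qr ^+ k = qr ^+ k * (qr ^+ (n - k) - 1).
  by rewrite mulrBr mulr1 -exprD subnKC // ltnW.
rewrite hq in e.
have nz : qr ^+ k * qfalling k k != 0.
  by rewrite mulf_neq0 ?qfalling_neq0 // expf_neq0 // pnatr_eq0; lia.
apply: (mulIf nz).
transitivity (G n k.+1 * ((qr ^+ k.+1 - 1) * qr ^+ k * qfalling k k)); first by ring.
by rewrite e; ring.
Qed.

Definition qslope (t : nat) : R := (qr ^+ t - 1) / t%:R.

Definition qslope_prod (x : nat) : R := \prod_(i < x) qslope i.+1.

Lemma qslope_prodSr x : qslope_prod x.+1 = qslope_prod x * qslope x.+1.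
Proof. by rewrite /qslope_prod big_ord_recr. Qed.

Lemma qslope_gt0 t : (0 < t)%N -> 0 < qslope t.
Proof. by move=> t0; rewrite divr_gt0 ?ltr0n // subr_gt0 -(expr0 qr) ltr_qX. Qed.

Lemma qslope_prod_gt0 x : 0 < qslope_prod x.
Proof. by rewrite prodr_gt0 // => i _; rewrite qslope_gt0. Qed.

Lemma qslope_leS t : (0 < t)%N -> qslope t <= qslope t.+1.
Proof.
move=> t0; rewrite /qslope ler_pdivrMr ?ltr0n // mulrAC ler_pdivlMr ?ltr0n //.
have hx : 1 <= qr ^+ t by rewrite exprn_ege1 // ler1n ltnW.
have hq : 2 <= qr by rewrite (ler_nat _ 2 q).
have ht : 1 <= t%:R :> R by rewrite ler1n.
rewrite exprS -natr1.
move: hx ht; set x := qr ^+ t; set T := t%:R => hx ht.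
have : 0 <= x * (T * (qr - 1) - 1) by rewrite mulr_ge0 //; nra.
nra.
Qed.

Lemma qslope_le s t : (0 < s)%N -> (s <= t)%N -> qslope s <= qslope t.
Proof.
move=> s0; elim: t => [|t IH] st; first lia.
have [le_st | lt_ts] := leqP s t; last by have -> : s = t.+1 by lia.
by apply: le_trans (IH le_st) (qslope_leS _); lia.
Qed.

Lemma qslope_prod_spread a b d : (a <= b)%N -> (d <= a)%N ->
  qslope_prod a * qslope_prod b <= qslope_prod (a - d) * qslope_prod (b + d).
Proof.
move=> ab; elim: d => [|d IH] da; first by rewrite subn0 addn0.
apply: le_trans (IH (ltnW da)) _.
rewrite (_ : a - d = (a - d.+1).+1)%N; last lia.
rewrite addnS !qslope_prodSr mulrAC [X in _ <= X]mulrA.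
rewrite ler_pM2l ?mulr_gt0 ?qslope_prod_gt0 //.
apply: qslope_le; lia.
Qed.

Lemma gauss_qslope_prod n k : (k <= n)%N ->
  G n k * (qslope_prod k * qslope_prod (n - k)) = ('C(n, k))%:R * qslope_prod n.
Proof.
elim: k => [|k IH] kn; first by rewrite gauss_n0 bin0 subn0 {1}/qslope_prod big_ord0 !mul1r.
have eG := gaussS_ratio kn.
have eC : (k.+1)%:R * ('C(n, k.+1))%:R = (n - k)%:R * ('C(n, k))%:R :> R.
  by rewrite -!natrM mul_bin_left.
rewrite (_ : n - k = (n - k.+1).+1)%N in IH eG eC; last lia.
rewrite !qslope_prodSr /qslope in IH.
have k1 : (k.+1)%:R != 0 :> R by rewrite pnatr_eq0.
apply: (mulfI k1); rewrite [RHS]mulrA eC -mulrA -(IH (ltnW kn)) qslope_prodSr /qslope.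
transitivity (qslope_prod k * qslope_prod (n - k.+1) * (G n k.+1 * (qr ^+ k.+1 - 1))).
  by field; rewrite addrC natr1.
by rewrite eG; field; rewrite addrC natr1 pnatr_eq0.
Qed.

Lemma qslope_prod_sym n x : (x <= n)%N ->
  qslope_prod x * qslope_prod (n - x) =
  qslope_prod (minn x (n - x)) * qslope_prod (n - minn x (n - x)).
Proof. by move=> xn; case: leqP => // _; rewrite subKn // mulrC. Qed.

Lemma gauss_bin_cross n j k : (j <= n)%N -> (k <= n)%N ->
  (minn j (n - j) <= minn k (n - k))%N ->
  G n j * ('C(n, k))%:R <= G n k * ('C(n, j))%:R.
Proof.
move=> jn kn mjk.
have [Xj Xk] : 0 < qslope_prod j * qslope_prod (n - j) /\
               0 < qslope_prod k * qslope_prod (n - k).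
  by split; rewrite mulr_gt0 ?qslope_prod_gt0.
have Xkj : qslope_prod k * qslope_prod (n - k) <= qslope_prod j * qslope_prod (n - j).
  rewrite (qslope_prod_sym kn) (qslope_prod_sym jn).
  set a := minn k (n - k); set b := minn j (n - j).
  have ha : (a <= n - a)%N by rewrite /a; lia.
  have := qslope_prod_spread ha (leq_subr b a).
  have -> : (a - (a - b) = b)%N by rewrite /a /b; lia.
  by have -> : (n - a + (a - b) = n - b)%N by rewrite /a /b; lia.
rewrite -(ler_pM2r Xj) -(ler_pM2r Xk).
rewrite [leLHS](_ : _ = ('C(n, j))%:R * ('C(n, k))%:R * qslope_prod n * (qslope_prod k * qslope_prod (n - k))).
  rewrite [leRHS](_ : _ = ('C(n, j))%:R * ('C(n, k))%:R * qslope_prod n * (qslope_prod j * qslope_prod (n - j))).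
    by rewrite ler_wpM2l // !mulr_ge0 // ltW // qslope_prod_gt0.
  transitivity (('C(n, j))%:R * (qslope_prod j * qslope_prod (n - j)) *
                (G n k * (qslope_prod k * qslope_prod (n - k)))); first by ring.
  by rewrite gauss_qslope_prod //; ring.
transitivity (('C(n, k))%:R * (qslope_prod k * qslope_prod (n - k)) *
              (G n j * (qslope_prod j * qslope_prod (n - j)))); first by ring.
by rewrite gauss_qslope_prod //; ring.
Qed.

End GaussianBinomial.

Lemma natr_qfalling (R : realFieldType) q n k : (0 < q)%N -> (k <= n)%N ->
  (\prod_(i < k) (q ^ n - q ^ i))%N%:R = qfalling R q n k.
Proof.
move=> q_gt0 kn; rewrite natr_prod; apply: eq_bigr => i _.
by rewrite natrB ?natrX // leq_pexp2l // ltnW // (leq_trans (ltn_ord i)).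
Qed.

Section FractionalKnapsack.
Variables (R : realFieldType) (I : finType) (M : pred I) (g c : I -> R) (r : R).
Hypotheses (g_gt0 : forall i, 0 < g i) (r_ge0 : 0 <= r).
Hypothesis cheap_M : forall i, M i -> r * c i <= g i.
Hypothesis costly_notM : forall i, ~~ M i -> g i <= r * c i.

Lemma fractional_knapsack (a : I -> R) (s : R) : 1 <= s ->
  (forall i, 0 <= a i <= g i) ->
  \sum_i a i * c i / g i <= s * \sum_(i | M i) c i ->
  \sum_i a i <= s * \sum_(i | M i) g i.
Proof.
move=> s_ge1 a_box budget.
have pointwise i : a i <= r * (a i * c i / g i) + (if M i then g i - r * c i else 0).
  have [a_ge0 a_le] := andP (a_box i); have gi0 := g_gt0 i.
  have gi_neq0 := lt0r_neq0 gi0.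
  set w := r * c i / g i.
  have -> : r * (a i * c i / g i) = a i * w by rewrite /w; ring.
  case: ifP => [Mi | /negbT nMi].
    have w_le1 : w <= 1 by rewrite ler_pdivrMr // mul1r cheap_M.
    have -> : g i - r * c i = g i * (1 - w) by rewrite /w; field.
    have : 0 <= (g i - a i) * (1 - w) by apply: mulr_ge0; lra.
    nra.
  have w_ge1 : 1 <= w by rewrite ler_pdivlMr // mul1r costly_notM.
  by rewrite addr0; nra.
have sum_pointwise := ler_sum (index_enum I) (fun i (_ : true) => pointwise i).
rewrite big_split /= -mulr_sumr -big_mkcond /= sumrB -mulr_sumr in sum_pointwise.
have r_cheap : r * \sum_(i | M i) c i <= \sum_(i | M i) g i.
  by rewrite mulr_sumr; apply: ler_sum => i; apply: cheap_M.
have := ler_wpM2l r_ge0 budget.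
nra.
Qed.

End FractionalKnapsack.

Definition middle_level (n m k : nat) : bool := ((n - m)./2 < k <= (n - m)./2 + m)%N.

Lemma middle_level_bounds n m : (m <= n)%N ->
  ((n - m)./2 <= n - (n - m)./2 /\ n - (n - m)./2 - m <= ((n - m)./2).+1)%N.
Proof. by move=> mn; have := odd_double_half (n - m); rewrite -addnn; case: odd => /=; lia. Qed.

Lemma sum_middle_levels (f : nat -> nat) n m : (m <= n)%N ->
  (\sum_(1 <= i < m.+1) f ((n - m)./2 + i) = \sum_(k < n.+1 | middle_level n m k) f k)%N.
Proof.
move=> mn; have [_ hm] := middle_level_bounds mn; set h := (n - m)./2 in hm *.
transitivity (\sum_(1 + h <= k < (h + m).+1) f k)%N.
  rewrite big_addn (_ : (h + m).+1 - h = m.+1)%N; last lia.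
  by apply: eq_bigr => i _; rewrite addnC.
rewrite (big_nat_widenl _ 0) // (big_nat_widen _ _ n.+1) -?big_mkord; last lia.
by apply: eq_bigl => k; rewrite /middle_level -/h; lia.
Qed.

Lemma middle_knapsack (q n m : nat) (a : nat -> rat) (s : rat) :
  (1 < q)%N -> (m <= n)%N -> 1 <= s ->
  (forall k, (k <= n)%N -> 0 <= a k <= (gauss q n k)%:R) ->
  \sum_(k < n.+1) a k * ('C(n, k))%:R / (gauss q n k)%:R <=
    s * \sum_(k < n.+1 | middle_level n m k) ('C(n, k))%:R ->
  \sum_(k < n.+1) a k <= s * \sum_(k < n.+1 | middle_level n m k) (gauss q n k)%:R.
Proof.
move=> q_gt1 mn s_ge1 a_box; have [h_le hm_le] := middle_level_bounds mn.
set h := (n - m)./2 in h_le hm_le *.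
have hn : (h <= n)%N by lia.
have C_gt0 k : (k <= n)%N -> 0 < ('C(n, k))%:R :> rat by move=> kn; rewrite ltr0n bin_gt0.
have ord_le_n (k : 'I_n.+1) : (k <= n)%N by rewrite -ltnS.
(* Level h lies just below the middle window: every level of the window is at least
   as close to n/2 as h, and every other level at most as close. *)
apply: (fractional_knapsack (M := fun k : 'I_n.+1 => middle_level n m k)
  (g := fun k => (gauss q n k)%:R) (c := fun k => ('C(n, k))%:R)
  (r := (gauss q n h)%:R / ('C(n, h))%:R)) => //.
- by move=> k; rewrite ltr0n gauss_gt0.
- by rewrite divr_ge0 // ltW ?C_gt0.
- move=> k mid_k; rewrite mulrAC ler_pdivrMr ?C_gt0 //.
  by apply: gauss_bin_cross => //; move: mid_k; rewrite /middle_level -/h; lia.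
- move=> k mid_k; rewrite mulrAC ler_pdivlMr ?C_gt0 //.
  by apply: gauss_bin_cross => //; move: mid_k; rewrite /middle_level -/h; lia.
- by move=> k; apply: a_box.
Qed.

Lemma sum_by_level (R : nmodType) (T : finType) (X : {set T}) (h : T -> nat) (N : nat)
    (w : nat -> R) : (forall x, (h x <= N)%N) ->
  \sum_(x in X) w (h x) = \sum_(k < N.+1) w k *+ #|[set x in X | h x == k]|.
Proof.
move=> hN; rewrite (partition_big (fun x => inord (h x) : 'I_N.+1) xpredT) //=.
apply: eq_bigr => k _; rewrite -sumr_const; apply: eq_big => [x | x /andP[_ /eqP <-]].
  by rewrite !inE -val_eqE /= inordK // ltnS.
by rewrite inordK // ltnS.
Qed.

Section RowFree.
Variable F : finFieldType.
Local Notation q := #|F|.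

Lemma card_row_span m n (A : 'M[F]_(m, n)) : row_free A ->
  #|[set v : 'rV[F]_n | (v <= A)%MS]| = (q ^ m)%N.
Proof.
move=> freeA; have [B AB1] := row_freeP freeA.
have -> : [set v : 'rV_n | (v <= A)%MS] = [set u *m A | u in 'rV_m].
  by apply/setP => v; rewrite inE; apply/submxP/imsetP => -[u]; exists u.
rewrite card_imset ?card_mx ?mul1n //.
by apply: can_inj (mulmx^~ B) _ => u; rewrite -mulmxA AB1 mulmx1.
Qed.

Lemma rank_col_mx_row m n (v : 'rV[F]_n) (A : 'M[F]_(m, n)) : ~~ (v <= A)%MS ->
  \rank (col_mx v A) = (\rank A).+1.
Proof.
move=> vA; rewrite -addsmxE; apply/eqP; rewrite eqn_leq.
have := mxrank_leqif_sup (addsmxSr v A); rewrite addsmx_sub submx_refl andbT.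
move=> /ltn_leqif ->; rewrite vA andbT.
by apply: leq_trans (mxrank_adds_leqif v A) _; have := rank_leq_row v; lia.
Qed.

Lemma row_free_col_mx_row m n (v : 'rV[F]_n) (A : 'M[F]_(m, n)) :
  row_free (col_mx v A) = row_free A && ~~ (v <= A)%MS.
Proof.
have [vA | nvA] := boolP (v <= A)%MS; last by rewrite /row_free rank_col_mx_row // andbT.
rewrite andbF /row_free -addsmxE (addsmx_idPr vA).
by apply/negbTE; rewrite neq_ltn ltnS rank_leq_row.
Qed.

Lemma card_row_free m n : (m <= n)%N ->
  #|[set A : 'M[F]_(m, n) | row_free A]| = (\prod_(i < m) (q ^ n - q ^ i))%N.
Proof.
elim: m => [_ | m IH lt_mn].
  rewrite big_ord0 (_ : [set A | _] = setT) ?cardsT ?card_mx //.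
  by apply/setP => A; rewrite !inE /row_free -leqn0 rank_leq_row.
rewrite big_ord_recr /= -(IH (ltnW lt_mn)) -sum_nat_const /= -sum1_card.
rewrite (partition_big (@dsubmx _ 1 m n) (fun D => row_free D)) => [|A]; last first.
  by rewrite inE -{1}(vsubmxK A) row_free_col_mx_row => /andP[].
apply: eq_big => [D | D freeD]; first by rewrite inE.
rewrite (reindex (col_mx^~ D)) /=; last first.
  exists usubmx => [v _ | A]; first by rewrite col_mxKu.
  by case/andP => _ /eqP <-; rewrite vsubmxK.
transitivity #|~: [set v : 'rV_n | (v <= D)%MS]|.
  rewrite -sum1_card; apply: eq_bigl => v.
  by rewrite !inE col_mxKd eqxx andbT row_free_col_mx_row freeD.
by rewrite cardsCs setCK card_row_span // card_mx mul1n.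
Qed.

End RowFree.

Section Subspaces.
Variables (F : finFieldType) (n : nat).

Definition rank_subspaces k : {set 'M[F]_n} :=
  [set A | is_subspace A && (\rank A == k)].

Lemma is_subspace_genmx r (X : 'M[F]_(r, n)) : is_subspace <<X>>%MS.
Proof. by rewrite /is_subspace genmx_id. Qed.

Lemma rank_eq_unitmx_mul (A A' : 'M[F]_n) : \rank A = \rank A' ->
  exists2 M, M \in unitmx & (A *m M == A')%MS.
Proof.
move=> rAA'.
have ebase (B : 'M[F]_n) : (B :=: (pid_mx (\rank B) : 'M_n) *m row_ebase B)%MS.
  rewrite -{1}(mulmx_ebase B) -mulmxA.
  by apply: eqmxMfull; rewrite row_full_unit col_ebase_unit.
exists (invmx (row_ebase A) *m row_ebase A').
  by rewrite unitmx_mul unitmx_inv !row_ebase_unit.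
apply/eqmxP; apply: eqmx_trans (eqmxMr _ (ebase A)) _.
by rewrite !mulmxA mulmxK ?row_ebase_unit // rAA'; apply: eqmx_sym.
Qed.

Section EquivariantCount.
Variables (T : finType) (p : pred T) (r : nat) (g : T -> 'M[F]_(r, n)).
Variable act : T -> 'M[F]_n -> T.
Hypothesis act_p : forall x M, M \in unitmx -> p x -> p (act x M).
Hypothesis act_g : forall x M, M \in unitmx -> (g (act x M) == g x *m M)%MS.
Hypothesis act_inj : forall M, M \in unitmx -> injective (act^~ M).

Lemma card_fiber_le (A A' : 'M[F]_n) :
  is_subspace A' -> \rank A = \rank A' ->
  (#|[set x | p x && (<<g x>>%MS == A)]| <= #|[set x | p x && (<<g x>>%MS == A')]|)%N.
Proof.
move=> sA' rAA'; have [M Mu AM] := rank_eq_unitmx_mul rAA'.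
rewrite -(card_imset _ (act_inj Mu)); apply/subset_leq_card/subsetP => _ /imsetP[x + ->].
rewrite !inE => /andP[px /eqP gxA]; rewrite act_p //= -(eqP sA').
apply/eqP/eq_genmx; apply: eqmx_trans (eqmxP (act_g x Mu)) _.
by apply: eqmx_trans (eqmxMr _ (eqmx_sym (genmxE (g x)))) _; rewrite gxA; apply/eqmxP.
Qed.

Lemma card_equivariant (k : nat) (A0 : 'M[F]_n) :
  (forall x, p x -> \rank (g x) = k) -> is_subspace A0 -> \rank A0 = k ->
  #|[set x | p x]| = (#|rank_subspaces k| * #|[set x | p x && (<<g x>>%MS == A0)]|)%N.
Proof.
move=> rank_g sA0 rA0.
rewrite -sum1_card (partition_big (fun x => <<g x>>%MS) (mem (rank_subspaces k))) /=;
  last by move=> x; rewrite !inE => px; rewrite is_subspace_genmx /= genmxE (rank_g x px).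
rewrite -sum_nat_const; apply: eq_bigr => A; rewrite inE => /andP[sA /eqP rA].
rewrite sum1dep_card (@eq_card _ _ [set x | p x & <<g x>>%MS == A]) => [|x]; last first.
  by rewrite !inE.
by apply/eqP; rewrite eqn_leq !card_fiber_le // rA.
Qed.
End EquivariantCount.

Lemma card_row_free_genmx_pid k : (k <= n)%N ->
  #|[set X : 'M[F]_(k, n) | row_free X & <<X>>%MS == <<pid_mx k : 'M_(k, n)>>%MS]| =
  #|[set Y : 'M[F]_k | row_free Y]|.
Proof.
move=> kn; pose P1 : 'M[F]_(n, k) := pid_mx k; pose P2 : 'M[F]_(k, n) := pid_mx k.
have P21 : P2 *m P1 = 1%:M by rewrite pid_mx_id // pid_mx_1.
have -> : [set X | row_free X & <<X>>%MS == <<P2>>%MS] = [set Y *m P2 | Y in [set Y : 'M[F]_k | row_free Y]].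
  apply/setP => X; rewrite inE; apply/andP/imsetP => [[freeX /eqP XP2] | [Y]].
    have /submxP[D XD] : (X <= P2)%MS by rewrite -genmxE XP2 genmxE.
    exists D => //; rewrite inE /row_free eqn_leq rank_leq_row -{1}(eqP freeX) XD.
    exact: mxrankM_maxl.
  rewrite inE => fullY ->; have YP2 := eqmxMfull P2 fullY.
  by rewrite (eq_genmx YP2) /row_free YP2 rank_pid_mx.
rewrite card_imset //; apply: can_inj (mulmx^~ P1) _ => Y.
by rewrite -mulmxA P21 mulmx1.
Qed.

Lemma card_rank_subspaces k : (k <= n)%N -> #|rank_subspaces k| = gauss #|F| n k.
Proof.
move=> kn; pose A0 := <<pid_mx k : 'M[F]_(k, n)>>%MS.
have count : #|[set X : 'M[F]_(k, n) | row_free X]| =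
    (#|rank_subspaces k| * #|[set X : 'M[F]_(k, n) | row_free X & <<X>>%MS == A0]|)%N.
  apply: (@card_equivariant _ (fun X => row_free X) k (fun X => X) (@mulmx _ k n n)).
  - by move=> X M Mu; rewrite /row_free mxrankMfree // row_free_unit.
  - by move=> X M _; rewrite submx_refl.
  - by move=> M Mu; apply: can_inj (mulmx^~ (invmx M)) _ => X; rewrite mulmxK.
  - by move=> X /eqP.
  - exact: is_subspace_genmx.
  - by rewrite genmxE rank_pid_mx.
rewrite card_row_free_genmx_pid // !card_row_free // in count.
have q_gt1 := card_finNzRing_gt1 F.
apply/eqP; rewrite -(eqr_nat rat); apply/eqP.
apply: (mulIf (qfalling_neq0 rat q_gt1 k)).
by rewrite gauss_qfalling -(natr_qfalling _ (ltnW q_gt1) kn) count natrM natr_qfalling // ltnW.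
Qed.

Definition sel_mx (S : {set 'I_n}) : 'M[F]_n := diag_mx (\row_i (i \in S)%:R).

Lemma sel_mxM (S S' : {set 'I_n}) : sel_mx S *m sel_mx S' = sel_mx (S :&: S').
Proof.
apply/matrixP => i j; rewrite mul_diag_mx !mxE in_setI.
by case: (i \in S); case: (i \in S'); case: (i == j); rewrite ?mul0r ?mul1r ?mulr1n ?mulr0n.
Qed.

Lemma sel_mx0 : sel_mx set0 = 0.
Proof. by apply/matrixP => i j; rewrite !mxE in_set0 mul0rn. Qed.

Lemma sel_mx_eq0 (S : {set 'I_n}) : (sel_mx S == 0) = (S == set0).
Proof.
apply/eqP/eqP => [/matrixP S0 | ->]; last exact: sel_mx0.
apply/setP => i; have := S0 i i; rewrite !mxE eqxx mulr1n in_set0.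
by case: (i \in S) => // /eqP; rewrite oner_eq0.
Qed.

Lemma sel_mx_sub (S S' : {set 'I_n}) : (sel_mx S <= sel_mx S')%MS = (S \subset S').
Proof.
apply/idP/idP => [/submxP[X SX] | sSS']; last by rewrite -(setIidPl sSS') -sel_mxM submxMl.
have : sel_mx S *m sel_mx (~: S') == 0.
  by rewrite SX -mulmxA sel_mxM setICr sel_mx0 mulmx0.
by rewrite sel_mxM sel_mx_eq0 -setDE setD_eq0.
Qed.

Lemma rank_sel_mx (S : {set 'I_n}) : \rank (sel_mx S) = #|S|.
Proof.
have rank_ge (S' : {set 'I_n}) : (#|S'| <= \rank (sel_mx S'))%N.
  pose f := @enum_val _ (mem S').
  have id_minor : rowsub f 1%:M *m sel_mx S' *m colsub f 1%:M = 1%:M :> 'M[F]_#|S'|.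
    rewrite mul_rowsub_mx mul1mx mulmx_colsub mulmx1.
    by apply/matrixP => i j; rewrite !mxE enum_valP (inj_eq enum_val_inj).
  rewrite -[X in (X <= _)%N](mxrank1 F) -id_minor.
  exact: leq_trans (mxrankM_maxl _ _) (mxrankM_maxr _ _).
have : (sel_mx (~: S) <= kermx (sel_mx S))%MS.
  by rewrite sub_kermx sel_mxM setIC setICr sel_mx0.
move=> /mxrankS; rewrite mxrank_ker.
have := cardsC S; rewrite card_ord.
have := rank_ge S; have := rank_ge (~: S); have := rank_leq_row (sel_mx S).
lia.
Qed.

Definition coord_count (A : 'M[F]_n) : nat :=
  #|[set x : 'M[F]_n * {set 'I_n} | (x.1 \in unitmx) && (<<sel_mx x.2 *m x.1>>%MS == A)]|.

Lemma rank_sel_mx_unit (S : {set 'I_n}) (B : 'M[F]_n) : B \in unitmx ->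
  \rank (sel_mx S *m B) = #|S|.
Proof. by move=> Bu; rewrite mxrankMfree ?rank_sel_mx // row_free_unit. Qed.

Lemma coord_count_rank (A : 'M[F]_n) : is_subspace A ->
  (coord_count A * #|rank_subspaces (\rank A)| =
   #|[set B : 'M[F]_n | B \in unitmx]| * 'C(n, \rank A))%N.
Proof.
move=> sA; pose k : nat := \rank A.
pose p (x : 'M[F]_n * {set 'I_n}) := (x.1 \in unitmx) && (#|x.2| == k).
pose g (x : 'M[F]_n * {set 'I_n}) := sel_mx x.2 *m x.1.
pose act (x : 'M[F]_n * {set 'I_n}) (M : 'M[F]_n) := (x.1 *m M, x.2).
have act_p x M : M \in unitmx -> p x -> p (act x M).
  by rewrite /p /= => Mu /andP[xu ->]; rewrite unitmx_mul xu Mu.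
have act_g x M : M \in unitmx -> (g (act x M) == g x *m M)%MS.
  by move=> _; rewrite /g /= mulmxA !submx_refl.
have act_inj M : M \in unitmx -> injective (act^~ M).
  by move=> Mu [B S] [B' S'] [/(can_inj (mulmxK Mu)) -> ->].
have rank_g x : p x -> \rank (g x) = k.
  by move=> /andP[xu /eqP <-]; rewrite rank_sel_mx_unit.
have := card_equivariant act_p act_g act_inj rank_g sA erefl.
have -> : [set x | p x] =
    setX [set B : 'M[F]_n | B \in unitmx] [set S : {set 'I_n} | #|S| == k].
  by apply/setP => -[B S]; rewrite !inE.
rewrite cardsX card_draws card_ord => ->; rewrite mulnC; congr (_ * _)%N.
apply: eq_card => -[B S]; rewrite !inE /p /g /=.
case Bu: (B \in unitmx) => //=.
case: eqP => [gA | _]; last by rewrite andbF.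
by rewrite /k -gA mxrank_gen rank_sel_mx_unit // eqxx.
Qed.

Lemma genmx_sel_mx_inj (B : 'M[F]_n) (S S' : {set 'I_n}) : B \in unitmx ->
  <<sel_mx S *m B>>%MS = <<sel_mx S' *m B>>%MS -> S = S'.
Proof.
move=> Bu /genmxP /andP[sub1 sub2].
have sub (X Y : {set 'I_n}) : (sel_mx X *m B <= sel_mx Y *m B)%MS -> X \subset Y.
  by move=> /(submxMr (invmx B)); rewrite !mulmxK // sel_mx_sub.
by apply/eqP; rewrite eqEsubset !sub.
Qed.

Lemma weakly_contains_sub_coord (d : Order.disp_t) (P : finPOrderType d)
    (Fam : {set 'M[F]_n}) (B : 'M[F]_n) : B \in unitmx ->
  weakly_contains_set P [set S | <<sel_mx S *m B>>%MS \in Fam] ->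
  weakly_contains_sub P Fam.
Proof.
move=> Bu /existsP[f /and3P[/injectiveP f_inj f_Fam f_mono]].
apply/existsP; exists [ffun x => <<sel_mx (f x) *m B>>%MS]; apply/and3P; split.
- by apply/injectiveP => x y; rewrite !ffunE => /(genmx_sel_mx_inj Bu) /f_inj.
- by apply/forallP => x; rewrite ffunE; have := forallP f_Fam x; rewrite inE.
apply/forallP => x; apply/forallP => y; apply/implyP => /(implyP (forallP (forallP f_mono x) y)).
move=> fxy; rewrite !ffunE ltmxErank !genmxE submxMr ?sel_mx_sub ?proper_sub //=.
by rewrite !rank_sel_mx_unit // proper_card.
Qed.

Lemma sum_coord_count_le (d : Order.disp_t) (P : finPOrderType d) (Fam : {set 'M[F]_n}) :
  ~~ weakly_contains_sub P Fam ->
  (\sum_(A in Fam) coord_count A <= #|[set B : 'M[F]_n | B \in unitmx]| * La P n)%N.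
Proof.
move=> Fam_free.
have -> : (\sum_(A in Fam) coord_count A =
    \sum_(B | B \in unitmx) \sum_(S | <<sel_mx S *m B>>%MS \in Fam) 1)%N.
  rewrite pair_big_dep (partition_big (fun x => <<sel_mx x.2 *m x.1>>%MS) (mem Fam)) /=; last by move=> x /andP[].
  apply: eq_bigr => A AF; rewrite /coord_count -sum1dep_card; apply: eq_bigl => x.
  by case: eqP => [-> | _]; rewrite ?AF ?andbT ?andbF.
rewrite -sum_nat_const; under [X in (_ <= X)%N]eq_bigl do rewrite inE.
apply: leq_sum => B Bu; rewrite sum1dep_card; apply: leq_bigmax_cond.
by apply: contra Fam_free; apply: weakly_contains_sub_coord.
Qed.

Lemma sum_bin_over_gauss_le_La (d : Order.disp_t) (P : finPOrderType d)
    (Fam : {set 'M[F]_n}) :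
  Fam \subset [set A | is_subspace A] -> ~~ weakly_contains_sub P Fam ->
  \sum_(A in Fam) ('C(n, \rank A))%:R / (gauss #|F| n (\rank A))%:R <= (La P n)%:R :> rat.
Proof.
move=> Fam_sub Fam_free; pose nGL := #|[set B : 'M[F]_n | B \in unitmx]|.
have nGL_gt0 : 0 < nGL%:R :> rat.
  by rewrite ltr0n; apply/card_gt0P; exists 1%:M; rewrite inE unitmx1.
have weight A : A \in Fam ->
    nGL%:R * (('C(n, \rank A))%:R / (gauss #|F| n (\rank A))%:R) = (coord_count A)%:R :> rat.
  move=> AF; have sA : is_subspace A by have := subsetP Fam_sub A AF; rewrite inE.
  have rA := rank_leq_row A.
  have G_neq0 : (gauss #|F| n (\rank A))%:R != 0 :> rat by rewrite pnatr_eq0 -lt0n gauss_gt0.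
  apply: (mulIf G_neq0); rewrite mulrA divfK // -!natrM -coord_count_rank //.
  by rewrite card_rank_subspaces.
rewrite -(ler_pM2l nGL_gt0) mulr_sumr (eq_bigr _ weight) -natr_sum -natrM ler_nat.
exact: sum_coord_count_le.
Qed.

End Subspaces.

Lemma card_by_rank (F : finFieldType) n (X : {set 'M[F]_n}) :
  (#|X|)%:R = \sum_(k < n.+1) (#|[set A in X | \rank A == k]|)%:R :> rat.
Proof.
rewrite -sumr_const (@sum_by_level _ _ X (fun A => \rank A) n (fun=> 1)) //.
exact: rank_leq_row.
Qed.

Lemma card_middle_levels_sub (F : finFieldType) n m : (m <= n)%N ->
  #|middle_levels_sub F n m| = Sigma_q #|F| n m.
Proof.
move=> mn; apply/eqP; rewrite -(eqr_nat rat) card_by_rank /Sigma_q sum_middle_levels //.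
rewrite natr_sum; apply/eqP; rewrite [RHS]big_mkcond /=; apply: eq_bigr => k _.
have kn : (k <= n)%N by rewrite -ltnS.
have -> : [set A in middle_levels_sub F n m | \rank A == k] =
    if middle_level n m k then rank_subspaces F n k else set0.
  apply/setP => A; rewrite /middle_levels_sub /middle_level.
  by case: ifP; rewrite !inE; case: eqP => [-> -> | _]; rewrite ?andbF ?andbT.
by case: ifP; rewrite ?cards0 ?card_rank_subspaces.
Qed.

Lemma Sigma_q_le_La_q (d : Order.disp_t) (P : finPOrderType d) (F : finFieldType) m n :
  eq_prop P F m -> (m <= n)%N -> (Sigma_q #|F| n m <= La_q P F n)%N.
Proof.
move=> mid_free mn; rewrite -card_middle_levels_sub //; apply: leq_bigmax_cond.
by rewrite mid_free andbT; apply/subsetP => A; rewrite !inE => /andP[].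
Qed.

Lemma La_q_le_Sigma_q (d : Order.disp_t) (P : finPOrderType d) (F : finFieldType) m n
    (s : rat) : (m <= n)%N -> 1 <= s ->
  (La P n)%:R <= s * (Sigma n m)%:R -> (La_q P F n)%:R <= s * (Sigma_q #|F| n m)%:R.
Proof.
move=> mn s_ge1 La_le.
apply: (big_ind (fun x : nat => x%:R <= s * (Sigma_q #|F| n m)%:R)).
- by rewrite mulr_ge0 // (le_trans ler01 s_ge1).
- by move=> x y ? ?; rewrite /maxn; case: ifP.
move=> Fam /andP[Fam_sub Fam_free].
rewrite card_by_rank /Sigma_q sum_middle_levels // natr_sum.
apply: (middle_knapsack (a := fun k => (#|[set A in Fam | \rank A == k]|)%:R)
  (card_finNzRing_gt1 F) mn s_ge1) => [k kn|].
  rewrite ler0n ler_nat -card_rank_subspaces //; apply/subset_leq_card/subsetP => A.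
  rewrite !inE => /andP[AF ->]; rewrite andbT.
  by have := subsetP Fam_sub A AF; rewrite inE.
under eq_bigr do rewrite -mulrA mulr_natl.
rewrite -(@sum_by_level _ _ Fam (fun A => \rank A) n
  (fun k => ('C(n, k))%:R / (gauss #|F| n k)%:R)) => [|A]; last exact: rank_leq_row.
apply: le_trans (sum_bin_over_gauss_le_La Fam_sub Fam_free) _.
by apply: le_trans La_le _; rewrite /Sigma sum_middle_levels // natr_sum.
Qed.

Theorem corollary1p5 (d : Order.disp_t) (P : finPOrderType d)
    (F : finFieldType) (m : nat) :
  is_e P m -> is_eq P F m ->
  asymp_one (fun n => La P n) (fun n => Sigma n m) ->
  asymp_one (fun n => La_q P F n) (fun n => Sigma_q #|F| n m).
Proof.
(* Neither e(P) = m nor the maximality of e_q(P) is needed: only the P-freeness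
   of the middle m levels enters. *)
move=> _ [mid_free _] La_asymp eps eps_gt0.
have [N La_near] := La_asymp eps eps_gt0.
exists (maxn N m) => n; rewrite geq_max => /andP[Nn mn].
have := Sigma_q_le_La_q mid_free mn; rewrite -(ler_nat rat) => lower.
have upper : (La_q P F n)%:R <= (1 + eps) * (Sigma_q #|F| n m)%:R :> rat.
  apply: La_q_le_Sigma_q mn _ _; first lra.
  by have := La_near n Nn; rewrite ler_norml => /andP[_]; lra.
have : 0 <= eps * (Sigma_q #|F| n m)%:R by rewrite mulr_ge0 // ltW.
by rewrite ler_norml; lra.
Qed.
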